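(* Consider the unit-demand Euclidean CVRP with any finite set $V$ of $n$ terminals in $\mathbb{R}^2$, any depot $O\in\mathbb{R}^2$ and any capacity $k\in\mathbb{N}^+$, and let $\mathrm{opt}$ be the cost of an optimal solution. Then for every $R\in\mathbb{R}^+\cup\{0,\infty\}$, \[\mathrm{opt}\ge T^*_R+\mathrm{rad}_R-\frac{3\pi D}{2},\] where $D$ is the diameter of $V\cup\{O\}$.
   Context: Unit-demand Euclidean CVRP: a solution is a set of tours, each a closed curve starting and ending at $O$ visiting at most $k$ terminals, with every terminal visited by some tour; cost is total Euclidean length. For $R\in\mathbb{R}^+\cup\{0,\infty\}$: the $R$-radial cost is $\mathrm{rad}_R:=\frac{2}{k}\sum_{v\in V}\min\{d(O,v),R\}$, and the $R$-local cost $T^*_R$ is the minimum length of a traveling salesman tour on the point set $\{v\in V: d(O,v)\ge R\}$ (taken to be $0$ if this set has at most one point). $d$ denotes Euclidean distance. *)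

(* Defs.v *)
From HB Require Import structures.
From mathcomp Require Import all_boot all_order all_algebra.
From mathcomp Require Import all_classical all_reals all_analysis.
Set Implicit Arguments. Unset Strict Implicit. Unset Printing Implicit Defensive.
Import Order.TTheory GRing.Theory Num.Theory.
Local Open Scope ring_scope.

Section CVRP.
Variable R : realType.

Definition pt := (R * R)%type.

Definition dist (p q : pt) : R :=
  Num.sqrt ((p.1 - q.1) ^+ 2 + (p.2 - q.2) ^+ 2).

Fixpoint path_len (s : seq pt) : R :=
  match s with
  | x :: ((y :: _) as s') => dist x y + path_len s'
  | _ => 0
  end.

Definition tour_len (O : pt) (t : seq pt) : R := path_len (O :: t ++ [:: O]).

Definition cvrp_solution (V : seq pt) (k : nat) (tours : seq (seq pt)) : Prop :=
  (forall t, t \in tours -> all (fun v => v \in V) t /\ (size (undup t) <= k)%N)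
  /\ (forall v, v \in V -> has (fun t => v \in t) tours).

Definition cvrp_cost (O : pt) (tours : seq (seq pt)) : R :=
  \sum_(t <- tours) tour_len O t.

Definition cycle_len (s : seq pt) : R :=
  match s with
  | [::] => 0
  | x :: _ => path_len (s ++ [:: x])
  end.

Definition tsp (P : seq pt) : R :=
  if (size P <= 1)%N then 0
  else \big[Num.min/cycle_len P]_(s <- permutations P) cycle_len s.

(* Extended radius parameter: [Some r] is r (with r >= 0), [None] is +infinity. *)
Definition min_ext (x : R) (Rad : option R) : R :=
  match Rad with Some r => Num.min x r | None => x end.

Definition far (O : pt) (Rad : option R) (v : pt) : bool :=
  match Rad with Some r => r <= dist O v | None => false end.

Definition rad_cost (O : pt) (V : seq pt) (k : nat) (Rad : option R) : R :=
  2 / k%:R * \sum_(v <- V) min_ext (dist O v) Rad.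

Definition local_cost (O : pt) (V : seq pt) (Rad : option R) : R :=
  tsp [seq v <- V | far O Rad v].

Definition diameter (P : seq pt) : R :=
  \big[Num.max/0]_(p <- P) \big[Num.max/0]_(q <- P) dist p q.

End CVRP.

(* Main.v *)
(** Cut each tour that leaves the disk of radius [r] around [O] at its first exit
    and last entry.  The two end pieces have total length at least [2 r], which
    pays for the radial cost of the tour; what remains is one leg per tour, with
    both ends on the circle and in the convex hull of the input.  All leg ends are
    vertices of a convex polygon of diameter at most [D], whose perimeter is at
    most [pi * D] by Cauchy's formula (used here in averaged form over finitely
    many directions).  The legs, this polygon and a perfect matching made of every
    second edge of another copy of it (the cheaper choice of the two) form a
    connected graph with even degrees, so they can be traversed by one closed curve
    through all the far terminals, of length at most that of the legs plus
    [3/2 * pi * D]. *)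

Require Import Defs.
From HB Require Import structures.
From mathcomp Require Import all_boot all_order all_algebra.
From mathcomp Require Import all_classical all_reals all_analysis.
From mathcomp Require Import ring lra zify.
Import Order.TTheory GRing.Theory Num.Theory.
Import numFieldNormedType.Exports.
Local Open Scope ring_scope.

(** * Euclidean distance *)

Lemma cauchy_schwarz2 {R : rcfType} (a b c d : R) :
  a * c + b * d <= Num.sqrt (a ^+ 2 + b ^+ 2) * Num.sqrt (c ^+ 2 + d ^+ 2).
Proof.
apply: le_trans (ler_norm _) _.
rewrite -sqrtrM ?addr_ge0 ?sqr_ge0// -sqrtr_sqr ler_wsqrtr//.
(* Lagrange's identity. *)
rewrite -subr_ge0 [X in 0 <= X](_ : _ = (a * d - b * c) ^+ 2) ?sqr_ge0//.
by ring.
Qed.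

Lemma minkowski2 {R : rcfType} (a b c d : R) :
  Num.sqrt ((a + c) ^+ 2 + (b + d) ^+ 2)
  <= Num.sqrt (a ^+ 2 + b ^+ 2) + Num.sqrt (c ^+ 2 + d ^+ 2).
Proof.
rewrite -[leRHS]ger0_norm ?addr_ge0 ?sqrtr_ge0// -sqrtr_sqr ler_wsqrtr//.
rewrite [leRHS]sqrrD !sqr_sqrtr ?addr_ge0 ?sqr_ge0//.
by have := cauchy_schwarz2 a b c d; lra.
Qed.

Lemma dist_ge0 {R : realType} (p q : pt R) : 0 <= dist p q.
Proof. exact: sqrtr_ge0. Qed.

Lemma dist_sym {R : realType} (p q : pt R) : dist p q = dist q p.
Proof. by rewrite /dist; congr Num.sqrt; ring. Qed.

Lemma distxx {R : realType} (p : pt R) : dist p p = 0.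
Proof. by rewrite /dist !subrr expr0n/= addr0 sqrtr0. Qed.

Lemma dist_triangle {R : realType} (q p s : pt R) :
  dist p s <= dist p q + dist q s.
Proof.
rewrite /dist.
rewrite (_ : p.1 - s.1 = (p.1 - q.1) + (q.1 - s.1)); last by ring.
rewrite (_ : p.2 - s.2 = (p.2 - q.2) + (q.2 - s.2)); last by ring.
exact: minkowski2.
Qed.

Lemma dist_dot {R : realType} (p q : pt R) (c s : R) : c ^+ 2 + s ^+ 2 = 1 ->
  (p.1 - q.1) * c + (p.2 - q.2) * s <= dist p q.
Proof.
move=> cs; have := cauchy_schwarz2 (p.1 - q.1) (p.2 - q.2) c s.
by rewrite cs sqrtr1 mulr1.
Qed.

Definition segpt {R : realType} (x y : pt R) (t : R) : pt R :=
  (x.1 + t * (y.1 - x.1), x.2 + t * (y.2 - x.2)).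

Lemma sqrt_scale {R : rcfType} (t a b : R) : 0 <= t ->
  Num.sqrt ((t * a) ^+ 2 + (t * b) ^+ 2) = t * Num.sqrt (a ^+ 2 + b ^+ 2).
Proof.
move=> t0; rewrite !exprMn -mulrDr sqrtrM ?sqr_ge0//.
by rewrite sqrtr_sqr ger0_norm.
Qed.

Lemma dist_segpt {R : realType} (x y : pt R) (t : R) : 0 <= t <= 1 ->
  dist x (segpt x y t) + dist (segpt x y t) y = dist x y.
Proof.
move=> /andP[t0 t1]; rewrite /dist /segpt /=.
rewrite (_ : x.1 - _ = t * (x.1 - y.1)); last by ring.
rewrite (_ : x.2 - _ = t * (x.2 - y.2)); last by ring.
rewrite (_ : x.1 + _ - _ = (1 - t) * (x.1 - y.1)); last by ring.
rewrite (_ : x.2 + _ - _ = (1 - t) * (x.2 - y.2)); last by ring.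
by rewrite !sqrt_scale ?subr_ge0//; ring.
Qed.

(** Balls are convex, because the distance to [p] is convex along a segment. *)
Lemma dist_segpt_le {R : realType} (x y p : pt R) (t D : R) : 0 <= t <= 1 ->
  dist x p <= D -> dist y p <= D -> dist (segpt x y t) p <= D.
Proof.
move=> /andP[t0 t1] xD yD.
apply: (@le_trans _ _ ((1 - t) * dist x p + t * dist y p)); last first.
  apply: (@le_trans _ _ ((1 - t) * D + t * D)); last by lra.
  by apply: lerD; apply: ler_wpM2l => //; rewrite subr_ge0.
rewrite /dist /segpt /= -!sqrt_scale ?subr_ge0//.
apply: le_trans (minkowski2 _ _ _ _).
by rewrite le_eqVlt; apply/orP; left; apply/eqP; congr Num.sqrt; ring.
Qed.

(** Intermediate value theorem. Squared distances are compared, so that the function of [t] is a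
    polynomial. *)
Lemma segpt_on_circle {R : realType} (O x y : pt R) (r : R) :
  0 <= r -> dist O x <= r -> r <= dist O y ->
  exists2 t, 0 <= t <= 1 & dist O (segpt x y t) = r.
Proof.
move=> r0 xr yr.
pose P : {poly R} :=
  ((x.1 - O.1)%:P + (y.1 - x.1)%:P * 'X) ^+ 2 +
  ((x.2 - O.2)%:P + (y.2 - x.2)%:P * 'X) ^+ 2 - (r ^+ 2)%:P.
have PE t : P.[t] = dist O (segpt x y t) ^+ 2 - r ^+ 2.
  rewrite /dist sqr_sqrtr ?addr_ge0 ?sqr_ge0// /segpt /P !hornerE/=.
  by ring.
have seg0 : segpt x y 0 = x by rewrite /segpt !mul0r !addr0; case: x {xr P PE}.
have seg1 : segpt x y 1 = y.
  by rewrite /segpt !mul1r !(addrC x.1) !(addrC x.2) !subrK; case: y {yr P PE seg0}.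
have [||t t01 /rootP] := @poly_ivt _ P 0 1; rewrite ?ler01//.
  rewrite !PE seg0 seg1 subr_le0 subr_ge0.
  by rewrite !lerXn2r ?nnegrE ?dist_ge0.
rewrite PE => /eqP; rewrite subr_eq0 eqrXn2 ?dist_ge0// => /eqP tr.
by exists t.
Qed.

(** * Open and closed polygonal sums *)

(** The edge weight is arbitrary because these sums serve both for lengths and for the variation of
    a projection along a polygon. *)
Fixpoint psum {R : realType} {T : Type} (f : T -> T -> R) (x : T) (s : seq T) : R :=
  if s is y :: s' then f x y + psum f y s' else 0.

Definition csum {R : realType} {T : Type} (f : T -> T -> R) (s : seq T) : R :=
  if s is x :: s' then psum f x s' + f (last x s') x else 0.

Lemma psum_cat {R : realType} {T : Type} (f : T -> T -> R) x s1 s2 :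
  psum f x (s1 ++ s2) = psum f x s1 + psum f (last x s1) s2.
Proof. by elim: s1 x => [|y s1 IH] x /=; rewrite ?add0r// IH addrA. Qed.

Lemma csum_catC {R : realType} {T : Type} (f : T -> T -> R) s1 s2 :
  csum f (s1 ++ s2) = csum f (s2 ++ s1).
Proof.
case: s1 s2 => [|x s1] [|y s2]; rewrite ?cats0//=.
by rewrite !psum_cat !last_cat /=; ring.
Qed.

Lemma csum_map {R : realType} {T U : Type} (f : U -> U -> R) (g : T -> U) s :
  csum f (map g s) = csum (fun x y => f (g x) (g y)) s.
Proof.
case: s => //= x s; rewrite last_map; congr (_ + _).
by elim: s x => //= y s IH x; rewrite IH.
Qed.

Lemma csumE {R : realType} {T : Type} (f : T -> T -> R) x s :
  csum f (x :: s) = \sum_(p <- zip (x :: s) (rcons s x)) f p.1 p.2.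
Proof.
(* The closing point is renamed [z], so that it stays fixed while the starting point varies in the
   induction. *)
rewrite /csum; have [z zx] : {z | z = x} by exists x.
rewrite -[X in f _ X]zx -[X in rcons _ X]zx => {zx}.
elim: s x => [|y s IH] x /=; first by rewrite add0r big_seq1.
by rewrite big_cons -addrA IH.
Qed.

Lemma ler_csum {R : realType} {T : eqType} (f g : T -> T -> R) s :
  {in s &, forall x y, f x y <= g x y} -> csum f s <= csum g s.
Proof.
case: s => //= x s fg; apply: lerD; last by apply: fg; rewrite ?mem_head ?mem_last.
elim: s x fg => //= y s IH x fg; apply: lerD.
  by apply: fg; rewrite ?mem_head// inE mem_head orbT.
by apply: IH => u v us vs; apply: fg; rewrite inE ?us ?vs orbT.
Qed.

Lemma csum_sum {R : realType} {T I : Type} (r : seq I) (F : I -> T -> T -> R) s :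
  csum (fun x y => \sum_(i <- r) F i x y) s = \sum_(i <- r) csum (F i) s.
Proof.
case: s => [|x s]; first by rewrite big1.
by rewrite csumE exchange_big; apply: eq_bigr => i _; rewrite csumE.
Qed.

Lemma csumZ {R : realType} {T : Type} (f : T -> T -> R) c s :
  csum (fun x y => c * f x y) s = c * csum f s.
Proof. by case: s => [|x s]; rewrite ?mulr0// !csumE mulr_sumr. Qed.

Lemma path_lenE {R : realType} (x : pt R) s : path_len (x :: s) = psum (@dist R) x s.
Proof. by elim: s x => //= y s IH x; rewrite -IH. Qed.

Lemma cycle_lenE {R : realType} (s : seq (pt R)) : cycle_len s = csum (@dist R) s.
Proof.
case: s => //= x s; rewrite -/(path_len (x :: (s ++ [:: x]))) path_lenE psum_cat.
by rewrite /= addr0.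
Qed.

Lemma psum_dist_ge0 {R : realType} (x : pt R) s : 0 <= psum (@dist R) x s.
Proof. by elim: s x => //= y s IH x; rewrite addr_ge0 ?dist_ge0. Qed.

Lemma dist_le_psum {R : realType} (x : pt R) s : dist x (last x s) <= psum (@dist R) x s.
Proof.
elim: s x => [|y s IH] x /=; first by rewrite distxx.
by apply: le_trans (dist_triangle y _ _) _; rewrite lerD2l.
Qed.

Lemma psum_dist_rev {R : realType} (x : pt R) s y :
  psum (@dist R) x (rcons s y) = psum (@dist R) y (rcons (rev s) x).
Proof.
elim: s x y => [|z s IH] x y /=; first by rewrite dist_sym.
rewrite IH rev_cons -!cats1 !psum_cat /= !last_cat /= !addr0 addrC.
by rewrite (dist_sym x).
Qed.

Lemma le_diameter {R : realType} (P : seq (pt R)) p q :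
  p \in P -> q \in P -> dist p q <= diameter P.
Proof.
move=> pP qP; rewrite /diameter.
apply: le_trans (le_bigmax_seq 0 p predT _ pP isT).
exact: (le_bigmax_seq 0 q predT _ qP isT).
Qed.

(** * Averaging over directions *)

Lemma le_sin_id {R : realType} (x : R) : 0 <= x -> sin x <= x.
Proof.
rewrite le_eqVlt => /predU1P[<-|x0]; first by rewrite sin0.
have [|c _] := @MVT R sin cos 0 x x0 (fun y _ => is_derive_sin y).
  apply: continuous_subspaceT => y; exact: continuous_sin.
rewrite sin0 !subr0 => ->.
by rewrite -[leRHS]mul1r ler_wpM2r ?cos_le1// ltW.
Qed.

Lemma ler_cos_0pi {R : realType} (x y : R) :
  0 <= x -> x <= y -> y <= pi -> cos y <= cos x.
Proof.
move=> x0; rewrite le_eqVlt => /predU1P[->//|xy] ypi; apply/ltW.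
by rewrite ltr_cos// in_itv/=; apply/andP; split=> //; lra.
Qed.

Lemma ler_cos_norm {R : realType} (x y : R) :
  `|x| <= y -> y <= pi -> cos y <= cos x.
Proof. by move=> xy ypi; rewrite -(cos_norm x); apply: ler_cos_0pi. Qed.

Lemma cosB_sin {R : realType} (a b : R) :
  cos a - cos b = - 2 * sin ((a + b) / 2) * sin ((a - b) / 2).
Proof.
rewrite [in cos a](_ : a = (a + b) / 2 + (a - b) / 2); last by field.
rewrite [in cos b](_ : b = (a + b) / 2 - (a - b) / 2); last by field.
by rewrite cosD cosB; ring.
Qed.

(* Replacing [|sin|] by [sin] before the index [m] and by [- sin] from it on only
   decreases the sum, and the result telescopes to [cos (x - 2 h m + h) / sin h];
   [m] is chosen so that this last argument is at most [h] in absolute value. *)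
Lemma sum_norm_sin_lt_pi {R : realType} (N : nat) (x h : R) :
  (0 < N)%N -> h = pi / (2 * N%:R) ->
  0 <= x < pi ->
  cos h <= sin h * \sum_(j < N) `|sin (x - 2 * h * j%:R)|.
Proof.
move=> N0 hE /andP[x0 xpi].
have pi0 : 0 < pi :> R := pi_gt0 R.
have NR : 1 <= N%:R :> R by rewrite ler1n.
have hN : 2 * h * N%:R = pi by rewrite hE; field; apply/eqP; lra.
have h0 : 0 < h by rewrite hE divr_gt0//; lra.
have hpi : h <= pi by nra.
have sh : 0 <= sin h by rewrite sin_ge0_pi// (ltW h0).
pose m := (Num.trunc (x / (2 * h))).+1.
have h20 : 0 < 2 * h by lra.
have xh : 0 <= x / (2 * h) by rewrite divr_ge0// ltW.
have mN : (m <= N)%N.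
  by rewrite /m truncn_lt_nat// ltr_pdivrMr// mulrC hN.
have /andP[m1 m2] := truncn_itv xh.
rewrite -/m in m2.
have {}m1 : m%:R - 1 <= x / (2 * h) by rewrite /m -natr1 addrK.
rewrite ler_pdivlMr// in m1.
rewrite ltr_pdivrMr// in m2.
pose g (j : nat) := cos (x - 2 * h * j%:R + h).
have gS j : g j.+1 - g j = 2 * (sin h * sin (x - 2 * h * j%:R)).
  rewrite /g cosB_sin -natr1.
  rewrite [in X in _ * X * _](_ : _ / 2 = x - 2 * h * j%:R); last by field.
  by rewrite [in X in _ * X](_ : _ / 2 = - h) ?sinN; [ring | field].
(* [N] steps of [2 * h] turn the argument by [pi]; hence [g 0] and [g N] cancel in the final sum and
   only [2 * g m] remains. *)
have gN : g N = - g 0%N.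
  rewrite /g mulr0 subr0 hN -[LHS]opprK -cosDpi; congr (- cos _); ring.
have tel a b : (a <= b)%N ->
    2 * (sin h * \sum_(a <= j < b) sin (x - 2 * h * j%:R)) = g b - g a.
  move=> ab; rewrite -(telescope_sumr g ab) mulr_sumr mulr_sumr.
  by apply: eq_bigr => j _; rewrite gS.
have gm : cos h <= g m by apply: ler_cos_norm => //; rewrite ler_norml; lra.
suff: \sum_(0 <= j < m) sin (x - 2 * h * j%:R)
      - \sum_(m <= j < N) sin (x - 2 * h * j%:R)
      <= \sum_(j < N) `|sin (x - 2 * h * j%:R)|.
  move=> /(ler_wpM2l sh); apply: le_trans.
  by have := tel _ _ (leq0n m); have := tel _ _ mN; rewrite gN; lra.
rewrite -(big_mkord xpredT (fun j => `|sin (x - 2 * h * j%:R)|)).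
rewrite (big_cat_nat (leq0n m) mN)/= -sumrN lerD//; apply: ler_sum => j _.
  exact: ler_norm.
by rewrite -normrN ler_norm.
Qed.

(** Since [|sin|] has period [pi], a negative [x] can be moved up by [pi], and [x = pi] down to
    [0]. *)
Lemma sum_norm_sin {R : realType} (N : nat) (x h : R) :
  (0 < N)%N -> h = pi / (2 * N%:R) ->
  -pi <= x <= pi ->
  cos h <= sin h * \sum_(j < N) `|sin (x - 2 * h * j%:R)|.
Proof.
move=> N0 hE /andP[x0 xpi].
have pi0 : 0 < pi :> R := pi_gt0 R.
have shift y : \sum_(j < N) `|sin (y - 2 * h * j%:R)|
             = \sum_(j < N) `|sin (y + pi - 2 * h * j%:R)|.
  apply: eq_bigr => j _; rewrite -[LHS]normrN -sinDpi; congr (`|sin _|); ring.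
have [xlt0|xge0] := ltP x 0.
  by rewrite shift; apply: sum_norm_sin_lt_pi => //; apply/andP; split; lra.
move: xpi; rewrite le_eqVlt => /predU1P[->|xpi].
  rewrite -[pi]add0r -shift; apply: sum_norm_sin_lt_pi => //.
  by rewrite lexx.
by apply: sum_norm_sin_lt_pi => //; rewrite xge0.
Qed.

(** * Polygons inscribed in a circle *)

Definition circ {R : realType} (O : pt R) (r a : R) : pt R :=
  (O.1 + r * cos a, O.2 + r * sin a).

Lemma dist_circ {R : realType} (O : pt R) (r a b : R) : 0 <= r ->
  dist (circ O r a) (circ O r b) = 2 * r * `|sin ((a - b) / 2)|.
Proof.
move=> r0; rewrite -[RHS]ger0_norm ?mulr_ge0// -sqrtr_sqr; congr Num.sqrt.
rewrite /circ/= exprMn real_normK ?num_real//.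
have := cosB a b; rewrite [in cos (a - b)](_ : a - b = (a - b) / 2 *+ 2); last first.
  by rewrite mulr2n; field.
rewrite cos_mulr2n cos2sin2 mulr2n.
have := cos2Dsin2 a; have := cos2Dsin2 b.
move: (sin ((a - b) / 2)) (cos a) (cos b) (sin a) (sin b) => s ca cb sa sb b1 a1 E.
have -> : (2 * r) ^+ 2 * s ^+ 2 = r ^+ 2 * (4 * s ^+ 2) by ring.
have -> : 4 * s ^+ 2 = (ca - cb) ^+ 2 + (sa - sb) ^+ 2 by lra.
ring.
Qed.

(** The angle is [acos] of the normalised first coordinate, negated when the second coordinate is
    negative. *)
Lemma circ_polar {R : realType} (O p : pt R) (r : R) : dist O p = r ->
  exists2 a, -pi <= a <= pi & p = circ O r a.
Proof.
have pi0 : 0 < pi :> R := pi_gt0 R.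
move=> Or; have r0 : 0 <= r by rewrite -Or dist_ge0.
have E : (p.1 - O.1) ^+ 2 + (p.2 - O.2) ^+ 2 = r ^+ 2.
  rewrite -Or dist_sym sqr_sqrtr// addr_ge0 ?sqr_ge0//.
move: r0; rewrite le_eqVlt => /predU1P[rE|r0].
  exists 0; first by apply/andP; split; lra.
  move: E; rewrite -rE expr0n/= => /eqP.
  rewrite paddr_eq0 ?sqr_ge0// !sqrf_eq0 !subr_eq0 => /andP[/eqP p1 /eqP p2].
  by rewrite /circ !mul0r !addr0 -p1 -p2; case: (p).
pose c := (p.1 - O.1) / r; pose s := (p.2 - O.2) / r.
have rn0 : r != 0 by rewrite gt_eqF.
have cs : c ^+ 2 + s ^+ 2 = 1.
  by rewrite /c /s !expr_div_n -mulrDl E divff// expf_neq0.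
have c1 : -1 <= c <= 1 by apply/andP; split; nra.
have /andP[ac0 acpi] : 0 <= acos c <= pi by rewrite acos_ge0// acos_lepi.
have ss : `|s| = sin (acos c).
  by rewrite sin_acos// -cs [_ + s ^+ 2]addrC addrK sqrtr_sqr.
have pE a : cos a = c -> sin a = s -> p = circ O r a.
  move=> ca sa; rewrite /circ ca sa /c /s !(mulrC r) !divfK//.
  by rewrite !(addrC O.1) !(addrC O.2) !subrK; case: (p).
have [s0|s0] := leP 0 s.
  exists (acos c); first by apply/andP; split; lra.
  by apply: pE; rewrite ?acosK ?in_itv//= -ss ger0_norm.
exists (- acos c); first by apply/andP; split; lra.
apply: pE; rewrite ?cosN ?acosK ?in_itv//= sinN -ss ltr0_norm// opprK//.
Qed.

Lemma circ_polar_seq {R : realType} (O : pt R) (r : R) (ps : seq (pt R)) :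
  {in ps, forall p, dist O p = r} ->
  exists2 s, {in s, forall a, -pi <= a <= pi} & ps = map (circ O r) s.
Proof.
elim: ps => [|p ps IH] Or; first by exists [::].
have [|s spi ->] := IH; first by move=> q qps; apply: Or; rewrite inE qps orbT.
have [|a api ->] := @circ_polar _ O p r; first by apply: Or; rewrite mem_head.
exists (a :: s) => // b; rewrite inE => /predU1P[->//|]; exact: spi.
Qed.

(** Discrete Cauchy formula for one chord. Its projection on the direction of angle [2 * h * j] is,
    up to sign, its length times a sine, so the sum over [j] factors and [sum_norm_sin] applies. *)
Lemma dist_circ_le_sum {R : realType} (N : nat) (O : pt R) (r h a b : R) :
  0 <= r -> (0 < N)%N -> h = pi / (2 * N%:R) ->
  -pi <= a <= pi -> -pi <= b <= pi ->
  cos h * dist (circ O r a) (circ O r b)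
  <= sin h * \sum_(j < N)
       `|r * cos (a - 2 * h * j%:R) - r * cos (b - 2 * h * j%:R)|.
Proof.
move=> r0 N0 hE /andP[a0 a1] /andP[b0 b1].
have -> : \sum_(j < N) `|r * cos (a - 2 * h * j%:R) - r * cos (b - 2 * h * j%:R)|
  = 2 * r * `|sin ((a - b) / 2)| *
    \sum_(j < N) `|sin ((a + b) / 2 - 2 * h * j%:R)|.
  rewrite mulr_sumr; apply: eq_bigr => j _.
  rewrite -mulrBr cosB_sin !normrM normrN (ger0_norm r0) [`|2|]ger0_norm//.
  rewrite [X in _ * (_ * `|sin X| * _)](_ : _ = (a + b) / 2 - 2 * h * j%:R); last by field.
  rewrite [X in _ * (_ * `|sin X|)](_ : _ = (a - b) / 2); last by field.
  by ring.
rewrite dist_circ// mulrC mulrCA ler_wpM2l ?mulr_ge0//.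
by apply: sum_norm_sin => //; apply/andP; split; lra.
Qed.

Lemma variation_cos_decr {R : realType} (f : R -> R) (r t a : R) (s : seq R) :
  (forall b, f b = r * cos (b - t)) -> 0 <= r ->
  sorted <=%R (a :: s) -> t <= a -> {in s, forall b, b <= t + pi} ->
  psum (fun x y => `|f x - f y|) a s = f a - f (last a s).
Proof.
move=> fE r0; elim: s a => [|b s IH] a srt ta itv; first by rewrite subrr.
have /andP[ab srt'] : (a <= b) && sorted <=%R (b :: s) := srt.
have bt := itv _ (mem_head _ _).
have fba : f b <= f a by rewrite !fE ler_wpM2l// ler_cos_0pi//; lra.
rewrite /= ger0_norm ?subr_ge0// IH ?(le_trans ta)//; first by lra.
by move=> c cs; rewrite itv// inE cs orbT.
Qed.

(* [cos (_ - t)] increases up to [t] and then decreases, so the variation is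
   governed by its largest value. *)
Lemma variation_cos {R : realType} (f : R -> R) (r t a : R) (s : seq R) :
  (forall b, f b = r * cos (b - t)) -> 0 <= r ->
  sorted <=%R (a :: s) -> {in a :: s, forall b, t - pi <= b <= t + pi} ->
  exists2 m, m \in a :: s &
    psum (fun x y => `|f x - f y|) a s <= 2 * f m - f a - f (last a s).
Proof.
move=> fE r0; elim: s a => [|b s IH] a srt itv.
  by exists a; rewrite ?mem_head//=; lra.
have /andP[ab srt'] : (a <= b) && sorted <=%R (b :: s) := srt.
have /andP[ta at_] := itv _ (mem_head _ _).
have itv' : {in b :: s, forall c, t - pi <= c <= t + pi}.
  by move=> c cs; rewrite itv// inE cs orbT.
(* If the peak [t] is not beyond [b], the values decrease from [b] on, and the largest one is taken
   at [a] or [b]. *)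
have [tb|bt] := leP t b.
  rewrite /= (@variation_cos_decr _ f r t)//; last first.
    by move=> c cs; have /andP[] := itv' c (mem_behead (s := b :: s) cs).
  have [fab|fba] := leP (f a) (f b).
    by exists b; rewrite ?inE ?eqxx ?orbT// ler0_norm ?subr_le0//; lra.
  by exists a; rewrite ?inE ?eqxx// gtr0_norm ?subr_gt0//; lra.
have fab : f a <= f b.
  rewrite !fE ler_wpM2l// -[cos (a - t)]cosN -[cos (b - t)]cosN.
  by rewrite ler_cos_0pi//; lra.
have [m ms mv] := IH b srt' itv'.
exists m; first by rewrite inE ms orbT.
by rewrite /= ler0_norm ?subr_le0//; lra.
Qed.

(** With the closing edge, the bound of [variation_cos] becomes twice the difference of [f m] and
    the smaller of the two end values. *)
Lemma closed_variation_cos {R : realType} (f : R -> R) (r t D : R) (s : seq R) :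
  (forall b, f b = r * cos (b - t)) -> 0 <= r -> 0 <= D ->
  sorted <=%R s -> {in s, forall b, t - pi <= b <= t + pi} ->
  {in s &, forall x y, f x - f y <= D} ->
  csum (fun x y => `|f x - f y|) s <= 2 * D.
Proof.
move=> fE r0 D0; case: s => [|a s] srt itv fD /=; first by lra.
have [m ms mv] := @variation_cos _ f r t a s fE r0 srt itv.
have ma := fD _ _ ms (mem_head _ _).
have ml := fD _ _ ms (mem_last _ _).
have [fl|fl] := leP (f a) (f (last a s)).
  by rewrite ger0_norm ?subr_ge0//; lra.
by rewrite ltr0_norm ?subr_lt0//; lra.
Qed.

Lemma sorted_filter_catC {R : realType} (c : R) (s : seq R) : sorted <=%R s ->
  s = [seq x <- s | x < c] ++ [seq x <- s | c <= x].
Proof.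
elim: s => //= x s IH xs; have ss := path_sorted xs.
have [xc|cx] := ltP x c; first by rewrite /= -IH.
have all_c : all (fun y => c <= y) s.
  by apply: sub_all (order_path_min le_trans xs) => y; apply: le_trans.
rewrite (all_filterP all_c) (eq_in_filter (a2 := pred0)) ?filter_pred0//.
by move=> y /(allP all_c); rewrite leNgt => /negbTE.
Qed.

(** Raising the angles below [t - pi] by [2 pi] keeps the values of [f]; rotating the cycle then
    gives a sorted list in the window [[t - pi, t + pi]]. *)
Lemma closed_variation_cos_pi {R : realType} (f : R -> R) (r t D : R) (s : seq R) :
  (forall b, f b = r * cos (b - t)) -> 0 <= r -> 0 <= D ->
  0 <= t <= pi -> sorted <=%R s -> {in s, forall b, -pi <= b <= pi} ->
  {in s &, forall x y, f x - f y <= D} ->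
  csum (fun x y => `|f x - f y|) s <= 2 * D.
Proof.
move=> fE r0 D0 /andP[t0 tpi] srt itv fD.
have pi0 : 0 < pi :> R := pi_gt0 R.
rewrite (sorted_filter_catC (t - pi) s srt) csum_catC.
set s1 := [seq x <- s | x < t - pi]; set s2 := [seq x <- s | t - pi <= x].
pose g x : R := x + pi *+ 2.
have fg x : f (g x) = f x by rewrite !fE /g addrAC cosD2pi.
have -> : csum (fun x y => `|f x - f y|) (s2 ++ s1)
        = csum (fun x y => `|f x - f y|) (s2 ++ map g s1).
  rewrite -[LHS](csum_map (fun x y => `|x - y|) f).
  rewrite -[RHS](csum_map (fun x y => `|x - y|) f) !map_cat -map_comp.
  by congr (csum _ (_ ++ _)); apply: eq_map => x /=; rewrite fg.
have s1P x : x \in s1 -> x \in s /\ x < t - pi.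
  by rewrite mem_filter => /andP[].
have s2P x : x \in s2 -> x \in s /\ t - pi <= x.
  by rewrite mem_filter => /andP[].
have s21P x : x \in s2 ++ map g s1 -> t - pi <= x <= t + pi.
  rewrite mem_cat => /orP[/s2P[/itv xpi tx]|/mapP[y /s1P[/itv ypi ty] ->]].
    by lra.
  by rewrite /g mulr2n; lra.
apply: (@closed_variation_cos _ f r t) => //.
- have srtP := srt; rewrite le_sorted_pairwise (sorted_filter_catC (t - pi) s srt) in srtP.
  move: srtP; rewrite pairwise_cat -/s1 -/s2 => /and3P[_ p1 p2].
  rewrite le_sorted_pairwise pairwise_cat p2 pairwise_map andTb; apply/andP; split.
    (* Entries of [s2] are at most [pi], shifted entries of [s1] at least [pi]. *)
    apply/allrelP => x _ /s2P[/itv xpi _] /mapP[y /s1P[/itv ypi _] ->].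
    by rewrite /g mulr2n; lra.
  by apply: sub_pairwise p1 => x y; rewrite /g /= lerD2r.
have sub : {subset map f (s2 ++ map g s1) <= map f s}.
  move=> _ /mapP[x + ->]; rewrite mem_cat => /orP[/s2P[xs _]|/mapP[y /s1P[ys _] ->]].
    exact: map_f.
  by rewrite fg map_f.
move=> x y /(map_f f)/sub/mapP[x' xs ->] /(map_f f)/sub/mapP[y' ys ->].
exact: fD.
Qed.

(** In each of [N] directions the projection of the closed polygon has variation at most [2 D].
    Summing gives [cos h * P <= pi * D] with [h = pi / (2 N)], and [h] can be made arbitrarily
    small. *)
Lemma inscribed_perimeter {R : realType} (O : pt R) (r D : R) (s : seq R) :
  0 <= r -> 0 <= D -> sorted <=%R s -> {in s, forall a, -pi <= a <= pi} ->
  {in s &, forall a b, dist (circ O r a) (circ O r b) <= D} ->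
  csum (@dist R) (map (circ O r) s) <= pi * D.
Proof.
move=> r0 D0 srt itv sD.
have pi0 : 0 < pi :> R := pi_gt0 R.
rewrite csum_map; set P := csum _ s.
have P0 : 0 <= P.
  rewrite /P; case: (s) => // a s'; rewrite csumE sumr_ge0// => p _.
  exact: dist_ge0.
have discrete N : (0 < N)%N -> cos (pi / (2 * N%:R)) * P <= pi * D.
  move=> N0; pose h : R := pi / (2 * N%:R); rewrite -/h.
  have NR : 1 <= N%:R :> R by rewrite ler1n.
  have hN : 2 * h * N%:R = pi by rewrite /h; field; apply/eqP; lra.
  have h0 : 0 < h by rewrite /h divr_gt0//; lra.
  have hpi : h <= pi by nra.
  have sh : 0 <= sin h by rewrite sin_ge0_pi// (ltW h0).
  rewrite /P -csumZ.
  pose F (j : 'I_N) (a b : R) :=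
    `|r * cos (a - 2 * h * j%:R) - r * cos (b - 2 * h * j%:R)|.
  apply: (@le_trans _ _ (csum (fun a b => sin h * \sum_j F j a b) s)).
    apply: ler_csum => a b /itv ai /itv bi.
    exact: dist_circ_le_sum.
  rewrite csumZ csum_sum.
  apply: (@le_trans _ _ (sin h * \sum_(j < N) (2 * D))).
    rewrite ler_wpM2l// ler_sum// => j _.
    have jN : j%:R <= N%:R :> R by rewrite ler_nat ltnW.
    have j0 : 0 <= j%:R :> R by rewrite ler0n.
    apply: (@closed_variation_cos_pi _ (fun a => r * cos (a - 2 * h * j%:R))
              r (2 * h * j%:R)) => //.
      by apply/andP; split; [apply: mulr_ge0 => //; lra | rewrite -hN ler_wpM2l//; lra].
    (* The difference is the projection of a chord on a unit vector. *)
    move=> a b sa sb /=; apply: le_trans (sD _ _ sa sb).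
    have := dist_dot (circ O r a) (circ O r b) _ _ (cos2Dsin2 (2 * h * j%:R)).
    by apply: le_trans; rewrite le_eqVlt !cosB /circ /=; apply/orP; left; apply/eqP; ring.
  rewrite sumr_const card_ord -[_ *+ N]mulr_natr.
  have : sin h * (2 * D * N%:R) <= h * (2 * D * N%:R).
    by apply: ler_wpM2r; [rewrite !mulr_ge0 | exact: le_sin_id (ltW h0)].
  by rewrite -hN; lra.
rewrite leNgt; apply/negP => PD.
have Pgt0 : 0 < P by apply: le_lt_trans PD; rewrite mulr_ge0// ltW.
(* This [N] makes [h * P < P - pi * D], which contradicts [(1 - h) * P <= pi * D]. *)
pose N := (Num.trunc (P * pi / (2 * (P - pi * D)))).+1.
have NP : P * pi / (2 * (P - pi * D)) < N%:R by apply: truncnS_gt.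
have := discrete N isT.
have NR : 1 <= N%:R :> R by rewrite ler1n.
set h := pi / (2 * N%:R).
have hN : 2 * h * N%:R = pi by rewrite /h; field; apply/eqP; lra.
have h0 : 0 < h by rewrite /h divr_gt0//; lra.
have h2 : h <= 2.
  by have /andP[_] := pihalf_02 R; nra.
(* From [1 - cos h = 2 sin^2 (h / 2) <= h^2 / 2] and [h <= 2]. *)
have ch : 1 - h <= cos h.
  have := cos0 R; rewrite -(subrr h) => c0.
  have := cosB_sin h 0; rewrite cos0 addr0 subr0.
  have sh0 : 0 <= sin (h / 2).
    by rewrite sin_ge0_pi//; apply/andP; split; have := pi_ge2 R; lra.
  have := le_sin_id (h / 2); nra.
move: NP; rewrite ltr_pdivrMr; last by lra.
move=> NP cP.
have hP : P - pi * D <= h * P by nra.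
by nra.
Qed.

(** The points are sorted by polar angle. Repeated points are kept, since the later parity arguments
    count ends with multiplicity. *)
Lemma circle_tour {R : realType} (O : pt R) (r D : R) (ps : seq (pt R)) :
  0 <= D -> {in ps, forall p, dist O p = r} -> {in ps &, forall p q, dist p q <= D} ->
  exists2 W, perm_eq W ps & csum (@dist R) W <= pi * D.
Proof.
case: ps => [|p ps] D0 Or pD; first by exists [::]; rewrite //= mulr_ge0 ?pi_ge0.
have r0 : 0 <= r by rewrite -(Or p) ?mem_head// dist_ge0.
have [s itv psE] := circ_polar_seq _ _ _ Or.
exists (map (circ O r) (sort <=%R s)); first by rewrite psE perm_map// perm_sort.
apply: inscribed_perimeter => //; first exact: sort_le_sorted.
  by move=> a; rewrite mem_sort => /itv.
by move=> a b; rewrite !mem_sort => sa sb; apply: pD; rewrite psE map_f.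
Qed.

(** * Eulerian splicing *)

(** An edge of a multigraph: one end, the points visited in between, the other end. *)
Notation leg R := (pt R * seq (pt R) * pt R)%type.

Definition leg_len {R : realType} (e : leg R) : R :=
  psum (@dist R) e.1.1 (rcons e.1.2 e.2).

(** The multiplicity of a point in this list is its degree in the multigraph; a closed leg counts
    twice. *)
Definition ends {R : realType} (E : seq (leg R)) : seq (pt R) :=
  flatten [seq [:: e.1.1; e.2] | e <- E].

Lemma ends_cons {R : realType} (e : leg R) E :
  ends (e :: E) = [:: e.1.1, e.2 & ends E].
Proof. by []. Qed.

Lemma ends_cat {R : realType} (E F : seq (leg R)) : ends (E ++ F) = ends E ++ ends F.
Proof. by rewrite /ends map_cat flatten_cat. Qed.

Lemma size_ends {R : realType} (E : seq (leg R)) : size (ends E) = (size E).*2.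
Proof. by elim: E => //= e E; rewrite /ends/= => ->. Qed.

Lemma leg_len_cat {R : realType} (a b c : pt R) s t :
  leg_len (a, s ++ b :: t, c) = leg_len (a, s, b) + leg_len (b, t, c).
Proof. by rewrite /leg_len/= -cat_rcons rcons_cat psum_cat last_rcons. Qed.

Lemma leg_orient {R : realType} (b : pt R) (e : leg R) :
  b \in [:: e.1.1; e.2] ->
  exists s d, [/\ leg_len (b, s, d) = leg_len e, {subset e.1.2 <= s}
                & perm_eq [:: b; d] [:: e.1.1; e.2]].
Proof.
case: e => [[a s] d] /=; rewrite !inE => /orP[/eqP ->|/eqP ->].
  by exists s, d; split.
exists (rev s), a; split.
- by rewrite /leg_len/= psum_dist_rev revK.
- by move=> x; rewrite mem_rev.
- by rewrite (perm_catC [:: d] [:: a]).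
Qed.

(* Two legs with a common end are glued into one, which keeps all degrees even,
   and a closed leg is inserted into the tour [W]. *)
Lemma splice_legs {R : realType} (E : seq (leg R)) (W : seq (pt R)) :
  (forall x, ~~ odd (count_mem x (ends E))) -> {subset ends E <= W} ->
  exists W' : seq (pt R), [/\ {subset W <= W'}, {in E, forall e : leg R, {subset e.1.2 <= W'}}
    & csum (@dist R) W' <= csum (@dist R) W + \sum_(e <- E) leg_len e].
Proof.
have [n] := ubnP (size E); elim: n => // n IH in E W *.
case: E => [|[[a s] b] E] szE ev EW.
  by exists W; split=> //; rewrite big_nil addr0.
have evE x : odd (count_mem x (ends E)) = odd ((a == x) + (b == x)).
  by have := ev x; rewrite ends_cons/= addnA oddD negb_add => /eqP.
have [ab|ab] := eqVneq a b.
  subst b.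
  have [w1 [w2 Wdef]] : exists w1 w2, W = w1 ++ a :: w2.
    have aW : a \in W by apply: EW; rewrite mem_head.
    by case/splitPr: aW => w1 w2; exists w1, w2.
  (* The tour is rotated to start at [a] and then makes the detour through [s] first. *)
  have Wc : csum (@dist R) (a :: s ++ a :: (w2 ++ w1))
      = csum (@dist R) W + leg_len (a, s, a).
    rewrite Wdef csum_catC cat_cons /csum /leg_len -cat_rcons psum_cat.
    by rewrite [last a (rcons _ _ ++ _)]last_cat last_rcons; ring.
  have [||| W' [sub inn len]] := IH E (a :: s ++ a :: (w2 ++ w1)) => //.
  - by move=> x; rewrite evE oddD addbb.
  - move=> x xE; have : x \in W by apply: EW; rewrite ends_cons !inE xE !orbT.
    rewrite Wdef !(inE, mem_cat) => /or3P[->|->|->]; by rewrite ?orbT.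
  exists W'; split.
  - move=> x; rewrite Wdef => xW; apply: sub.
    by move: xW; rewrite !(inE, mem_cat) => /or3P[->|->|->]; rewrite ?orbT.
  - move=> e; rewrite inE => /predU1P[->|/inn//] x /= xs; apply: sub.
    by rewrite !(inE, mem_cat) xs orbT.
  - by apply: le_trans len _; rewrite Wc big_cons addrA.
(* As [a != b], the degree of [b] in the remaining legs is odd, so one of them ends at [b]. *)
have [e eE be] : exists2 e, e \in E & b \in [:: e.1.1; e.2].
  have : b \in ends E.
    by rewrite -has_pred1 has_count odd_gt0// evE eqxx (negbTE ab).
  by move=> /flatten_mapP[e eE be]; exists e.
have [s' [d [len' in' perm']]] := leg_orient b e be.
have [E1 [E2 Edef]] : exists E1 E2, E = E1 ++ e :: E2.
  by case/splitPr: eE => E1 E2; exists E1, E2.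
pose e' : leg R := (a, s ++ b :: s', d).
have cnt x : ((b == x) + (d == x) = (e.1.1 == x) + (e.2 == x))%N.
  by move/permP: perm' => /(_ (pred1 x)); rewrite /= !addn0.
have cntE x : count_mem x (ends E)
    = (count_mem x (ends (E1 ++ E2)) + ((b == x) + (d == x)))%N.
  rewrite cnt Edef !ends_cat ends_cons !count_cat /=.
  by rewrite -[RHS]addnA; congr (_ + _)%N; rewrite [RHS]addnC -addnA.
have [||| W' [sub inn len]] := IH (e' :: (E1 ++ E2)) W => //.
- by move: szE; rewrite Edef /= !size_cat /=; lia.
- move=> x; have := evE x; rewrite cntE ends_cons/=.
  by rewrite !oddD; case: (odd _) (a == x) (b == x) (d == x) => [] [] [] [].
- move=> x; rewrite inE => /predU1P[->|]; first by apply: EW; rewrite mem_head.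
  rewrite inE => /predU1P[->|].
    apply: EW; rewrite ends_cons 2!inE.
    by rewrite -[d \in _]has_pred1 has_count cntE eqxx addn1 addnS !orbT.
  move=> xE; apply: EW; rewrite ends_cons 2!inE.
  move: xE; rewrite -!has_pred1 !has_count cntE addn_gt0 => ->.
  by rewrite !orbT.
exists W'; split=> //.
- have in_e' := inn e' (mem_head _ _).
  move=> f; rewrite inE => /predU1P[-> x /= xs|].
    by apply: in_e'; rewrite /= mem_cat xs.
  rewrite Edef mem_cat inE => /or3P[fE|/eqP -> x /in' xs|fE].
  + by apply: inn; rewrite inE mem_cat fE orbT.
  + by apply: in_e'; rewrite /= mem_cat inE xs !orbT.
  + by apply: inn; rewrite inE mem_cat fE !orbT.
- apply: le_trans len _; rewrite lerD2l Edef !(big_cons, big_cat)/=.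
  by rewrite leg_len_cat len'; lra.
Qed.

Fixpoint alternate {R : realType} (s : seq (pt R)) : seq (leg R) :=
  if s is x :: y :: s' then (x, [::], y) :: alternate s' else [::].

Lemma ends_alternate {R : realType} (s : seq (pt R)) :
  ~~ odd (size s) -> ends (alternate s) = s.
Proof.
have [n] := ubnP (size s); elim: n s => // n IH [|x [|y s]]//= sn.
by rewrite negbK => es; rewrite ends_cons IH//; lia.
Qed.

(** The two alternations, started one point apart, share out the edges of the path from [x] through
    [s] to [y]. Keeping [y] apart from [x] lets the induction run; the closed polygon is the case
    [y = x]. *)
Lemma len_alternate {R : realType} (x y : pt R) (s : seq (pt R)) : odd (size s) ->
  \sum_(e <- alternate (x :: s)) leg_len e + \sum_(e <- alternate (rcons s y)) leg_len e
  = psum (@dist R) x s + dist (last x s) y.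
Proof.
have [n] := ubnP (size s); elim: n x s => // n IH x [|z [|w s]]//= sn.
  by rewrite !big_cons !big_nil /leg_len/= ; lra.
rewrite negbK => os; rewrite [in LHS]big_cons [X in _ + X]big_cons.
have := IH w s; rewrite os => /(_ _ isT).
rewrite /leg_len/= => IHs.
have {}IHs := IHs ltac:(lia); lra.
Qed.

(* Every second edge of a closed polygon through evenly many points is a perfect
   matching; the better of the two choices has at most half of its length. *)
Lemma cheap_matching {R : realType} (W : seq (pt R)) : ~~ odd (size W) ->
  exists M : seq (leg R), perm_eq (ends M) W /\
    2 * \sum_(e <- M) leg_len e <= csum (@dist R) W.
Proof.
case: W => [|x s] /=; first by exists [::]; rewrite big_nil mulr0.
rewrite negbK => os; have := len_alternate x x s os.
set A := \sum_(e <- alternate (x :: s)) _; set B := \sum_(e <- alternate _) _ => AB.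
have [AleB|BltA] := leP A B.
  exists (alternate (x :: s)); split; last by rewrite -/A; lra.
  by rewrite ends_alternate//= negbK.
exists (alternate (rcons s x)); split; last by rewrite -/B; lra.
by rewrite ends_alternate ?size_rcons//= ?negbK// perm_rcons.
Qed.

(** [W] is paid once as the tour into which everything is spliced, and half more for a matching [M].
    The ends of [M] repeat those of [E], which makes all degrees even. *)
Lemma connect_legs {R : realType} (E : seq (leg R)) (W : seq (pt R)) :
  perm_eq W (ends E) ->
  exists2 W' : seq (pt R), {in E, forall e : leg R, {subset e.1.2 <= W'}} &
    csum (@dist R) W' <= 3 / 2 * csum (@dist R) W + \sum_(e <- E) leg_len e.
Proof.
move=> WE.
have [|M [MW lenM]] := cheap_matching W.
  by rewrite (perm_size WE) size_ends odd_double.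
have ME : perm_eq (ends M) (ends E) := perm_trans MW WE.
have [||W' [_ inn len]] := splice_legs (E ++ M) W.
- move=> x; rewrite ends_cat count_cat (permP ME) addnn odd_double//.
- by move=> x; rewrite ends_cat mem_cat (perm_mem WE) (perm_mem ME) orbb.
exists W'; first by move=> e eE; apply: inn; rewrite mem_cat eE.
by apply: le_trans len _; rewrite big_cat/=; lra.
Qed.

(** * Shortcutting closed tours *)

Lemma cycle_len_cons {R : realType} (x : pt R) s :
  csum (@dist R) s <= csum (@dist R) (x :: s).
Proof.
case: s => [|y s] /=; first by rewrite add0r dist_ge0.
have := dist_triangle x (last y s) y; lra.
Qed.

Lemma cycle_len_subseq {R : realType} (s t : seq (pt R)) :
  subseq s t -> csum (@dist R) s <= csum (@dist R) t.
Proof.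
(* The prefix [p] collects the entries already kept; rotation then brings an entry to be dropped to
   the front. *)
suff gen p : subseq s t -> csum (@dist R) (p ++ s) <= csum (@dist R) (p ++ t).
  exact: (gen [::]).
elim: t s p => [|y t IH] s p.
  by rewrite subseq0 => /eqP ->.
case: s => [|x s] /=.
  move=> _; apply: le_trans (IH [::] p (sub0seq _)) _.
  by rewrite csum_catC [leRHS]csum_catC /= cycle_len_cons.
case: eqP => [->|_] st.
  by rewrite -!cat_rcons IH.
apply: le_trans (IH _ p st) _.
by rewrite csum_catC [leRHS]csum_catC cycle_len_cons.
Qed.

(** Deleting from [W] the points outside [F] and all repetitions leaves an ordering of [F] that is
    no longer than [W]. *)
Lemma tsp_le {R : realType} (F W : seq (pt R)) : uniq F -> {subset F <= W} ->
  tsp F <= csum (@dist R) W.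
Proof.
move=> uF FW; rewrite /tsp; case: ifP => [_|_].
  case: W FW => // x s _; rewrite csumE sumr_ge0// => p _; exact: dist_ge0.
pose s := undup [seq w <- W | w \in F].
have sF : perm_eq s F.
  apply: uniq_perm; rewrite ?undup_uniq// => x.
  by rewrite mem_undup mem_filter; case: (boolP (x \in F)) => // /FW ->.
apply: (@le_trans _ _ (cycle_len s)).
  by apply: ge_bigmin_seq; rewrite ?mem_permutations.
rewrite cycle_lenE cycle_len_subseq//.
exact: subseq_trans (undup_subseq _) (filter_subseq _ _).
Qed.

(** * Cutting the tours at the circle *)

Lemma tour_lenE {R : realType} (O : pt R) t :
  tour_len O t = psum (@dist R) O (t ++ [:: O]).
Proof. exact: path_lenE. Qed.

Lemma tour_len_ge {R : realType} (O v : pt R) t :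
  v \in t -> 2 * dist O v <= tour_len O t.
Proof.
rewrite tour_lenE => /splitPr[t1 t2]; rewrite -catA cat_cons -cat_rcons psum_cat last_rcons.
have := dist_le_psum O (rcons t1 v); rewrite last_rcons.
have := dist_le_psum v (t2 ++ [:: O]); rewrite last_cat/= (dist_sym v).
lra.
Qed.

(** [t'] is the tail of [t] from its first far point on, and [a] lies on the edge that leads there.
    [K] is any convex set, and [w] is the continuation left untouched. *)
Lemma first_crossing {R : realType} (K : pt R -> Prop) (O x : pt R) (r : R)
    (t w : seq (pt R)) :
  (forall u v a, 0 <= a <= 1 -> K u -> K v -> K (segpt u v a)) ->
  0 <= r -> dist O x <= r -> K x -> {in t, forall y, K y} ->
  has (fun y => r <= dist O y) t ->
  exists a t', [/\ dist O a = r, K a, {subset t' <= t},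
    {in t, forall y, r <= dist O y -> y \in t'} &
    dist x a + psum (@dist R) a (t' ++ w) <= psum (@dist R) x (t ++ w)].
Proof.
move=> Kseg r0; elim: t x => //= y t IH x Ox Kx Kt.
have Ky : K y by apply: Kt; rewrite mem_head.
have [yfar _|ynear /= tfar] := leP r (dist O y).
  have [c c01 Oc] := segpt_on_circle _ _ _ _ r0 Ox yfar.
  exists (segpt x y c), (y :: t); split=> //; first exact: Kseg.
  by rewrite /= -(dist_segpt x y c c01); lra.
have Kt' : {in t, forall z, K z} by move=> z zt; apply: Kt; rewrite inE zt orbT.
have [a [t' [Oa Ka t't far len]]] := IH y (ltW ynear) Ky Kt' tfar.
exists a, t'; split=> //.
- by move=> z /t't zt; rewrite inE zt orbT.
- by move=> z; rewrite inE => /predU1P[->|/far//]; rewrite leNgt ynear.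
- by have := dist_triangle y x a; lra.
Qed.

Lemma tour_leg {R : realType} (K : pt R -> Prop) (O : pt R) (r : R)
    (t : seq (pt R)) :
  (forall u v a, 0 <= a <= 1 -> K u -> K v -> K (segpt u v a)) ->
  0 <= r -> K O -> {in t, forall y, K y} ->
  has (fun y => r <= dist O y) t ->
  exists e : leg R, [/\ {in [:: e.1.1; e.2], forall p, dist O p = r /\ K p},
    {in t, forall y, r <= dist O y -> y \in e.1.2} &
    2 * r + leg_len e <= tour_len O t].
Proof.
move=> Kseg r0 KO Kt tfar; have OO : dist O O <= r by rewrite distxx.
have [a [t1 [Oa Ka t1t far1 len1]]] := first_crossing K O O r t [:: O] Kseg r0 OO KO Kt tfar.
have Kt1 : {in rev t1, forall y, K y} by move=> y; rewrite mem_rev => /t1t/Kt.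
have t1far : has (fun y => r <= dist O y) (rev t1).
  have /hasP[y yt yfar] := tfar.
  by apply/hasP; exists y; rewrite // mem_rev far1.
(* Backwards, the rest of the tour runs from [O] through [rev t1] to [a]; its first exit is the last
   entry of the tour. *)
have [b [t2 [Ob Kb _ far2 len2]]] :=
  first_crossing K O O r (rev t1) [:: a] Kseg r0 OO KO Kt1 t1far.
exists (b, t2, a); split.
- by move=> p; rewrite !inE => /orP[/eqP->|/eqP->].
- by move=> y /far1 yt1 yfar; apply: far2; rewrite // mem_rev yt1.
- move: len1 len2; rewrite tour_lenE Oa Ob /leg_len /= !cats1 (psum_dist_rev a).
  lra.
Qed.

(** * Accounting for the radial cost *)

(** Each of at most [k] terminals contributes at most [2 M / k]. Below, [M] is either [r] or half
    the length of the tour. *)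
Lemma radial_tour {R : realType} (k : nat) (f : pt R -> R) (M : R) (t : seq (pt R)) :
  (0 < k)%N -> (size (undup t) <= k)%N -> 0 <= M -> {in t, forall v, f v <= M} ->
  2 / k%:R * \sum_(v <- undup t) f v <= 2 * M.
Proof.
move=> k0 tk M0 fM; have kR : 0 < k%:R :> R by rewrite ltr0n.
apply: (@le_trans _ _ (2 / k%:R * (k%:R * M))); last by rewrite mulrA divfK ?gt_eqF.
apply: ler_wpM2l; first by rewrite divr_ge0// ltW.
apply: (@le_trans _ _ ((size (undup t))%:R * M)).
  have -> : (size (undup t))%:R * M = \sum_(v <- undup t) M.
    by rewrite big_const_seq count_predT iter_addr addr0 mulr_natl.
  rewrite big_seq [leRHS]big_seq.
  by apply: ler_sum => v; rewrite mem_undup => /fM.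
by rewrite ler_wpM2r// ler_nat.
Qed.

Lemma ler_sum_sub_uniq {R : realType} {T : eqType} (f : T -> R) (s u : seq T) :
  (forall x, 0 <= f x) -> uniq s -> {subset s <= u} ->
  \sum_(x <- s) f x <= \sum_(x <- u) f x.
Proof.
move=> f0; elim: s u => [|x s IH] u /=; first by rewrite big_nil sumr_ge0.
move=> /andP[xs us] su.
have [u1 [u2 uE]] : exists u1 u2, u = u1 ++ x :: u2.
  have xu : x \in u by apply: su; rewrite mem_head.
  by case/splitPr: xu => u1 u2; exists u1, u2.
rewrite uE big_cons big_cat big_cons/= addrCA lerD2l -big_cat.
apply: IH => // y ys; have := su y; rewrite uE inE ys orbT !mem_cat inE => /(_ isT).
by case: eqP => // yx; rewrite yx (negbTE xs) in ys.
Qed.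

(** Only an inequality, since a terminal may lie on several tours. *)
Lemma radial_cover {R : realType} (f : pt R -> R) (V : seq (pt R)) (k : nat) tours :
  (forall x, 0 <= f x) -> uniq V -> cvrp_solution V k tours ->
  \sum_(v <- V) f v <= \sum_(t <- tours) \sum_(v <- undup t) f v.
Proof.
move=> f0 uV [_ cover].
rewrite -(big_map undup predT (fun t => \sum_(v <- t) f v)) -big_flatten.
apply: ler_sum_sub_uniq => // v /cover /hasP[t tt vt].
by apply/flatten_mapP; exists t; rewrite // mem_undup.
Qed.

Lemma tours_legs {R : realType} (K : pt R -> Prop) (O : pt R) (r : R) (k : nat)
    (tours : seq (seq (pt R))) :
  (forall u v a, 0 <= a <= 1 -> K u -> K v -> K (segpt u v a)) ->
  0 <= r -> (0 < k)%N -> K O ->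
  {in tours, forall t, {in t, forall y, K y} /\ (size (undup t) <= k)%N} ->
  exists E : seq (leg R), [/\ {in ends E, forall p, dist O p = r /\ K p},
    {in tours, forall t, {in t, forall v, r <= dist O v ->
       exists2 e, e \in E & v \in e.1.2}} &
    2 / k%:R * (\sum_(t <- tours) \sum_(v <- undup t) Num.min (dist O v) r)
    + \sum_(e <- E) leg_len e <= cvrp_cost O tours].
Proof.
move=> Kseg r0 k0 KO; rewrite /cvrp_cost; elim: tours => [|t tours IH] Kt.
  by exists [::]; split; rewrite // !big_nil mulr0 addr0.
have [|E [endE farE lenE]] := IH.
  by move=> u us; apply: Kt; rewrite inE us orbT.
have [Ktt tk] := Kt t (mem_head _ _).
have [tfar|tnear] := boolP (has (fun y => r <= dist O y) t).
  have [e [ende fare lene]] := tour_leg K O r t Kseg r0 KO Ktt tfar.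
  exists (e :: E); split.
  - move=> p; rewrite ends_cons -[_ :: _]/([:: e.1.1; e.2] ++ ends E) mem_cat => /orP[]; first exact: ende.
    exact: endE.
  - move=> u; rewrite inE => /predU1P[->|ut] v vu vfar.
      by exists e; rewrite ?mem_head// fare.
    have [e' e'E ve'] := farE u ut v vu vfar.
    by exists e'; rewrite // inE e'E orbT.
  - rewrite !big_cons mulrDr.
    have : 2 / k%:R * \sum_(v <- undup t) Num.min (dist O v) r <= 2 * r.
      by apply: radial_tour => // v _; rewrite ge_min lexx orbT.
    by lra.
(* A tour without far points yields no leg; its whole length pays for its radial cost. *)
exists E; split=> //.
  move=> u; rewrite inE => /predU1P[->|]; last exact: farE.
  by move=> v vt vfar; case/negP: tnear; apply/hasP; exists v.
rewrite !big_cons mulrDr.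
have : 2 / k%:R * \sum_(v <- undup t) Num.min (dist O v) r <= 2 * (tour_len O t / 2).
  apply: radial_tour => //; first by rewrite divr_ge0// tour_lenE psum_dist_ge0.
  by move=> v /(tour_len_ge O); rewrite ge_min => ?; apply/orP; left; lra.
by lra.
Qed.

Theorem theorem5 (R : realType) (V : seq (pt R)) (O : pt R) (k : nat)
    (Rad : option R) :
  uniq V -> (0 < k)%N ->
  (forall r, Rad = Some r -> 0 <= r) ->
  forall tours : seq (seq (pt R)), cvrp_solution V k tours ->
  cvrp_cost O tours >=
    local_cost O V Rad + rad_cost O V k Rad
    - 3 * pi * diameter (O :: V) / 2.
Proof.
move=> uV k0 Rad0 tours sol.
set D := diameter _; have OV : O \in O :: V := mem_head _ _.
have D0 : 0 <= D by rewrite -(distxx O) le_diameter.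
have pi0 : 0 < pi :> R := pi_gt0 R.
have kR : 0 <= 2 / k%:R :> R by rewrite divr_ge0.
(* For infinite radius no terminal is far, and the radial bound alone suffices. *)
case: Rad Rad0 => [r|] Rad0; last first.
  have -> : local_cost O V None = 0 by rewrite /local_cost filter_pred0.
  have : rad_cost O V k None <= cvrp_cost O tours.
    have := radial_cover (dist O) V k tours (dist_ge0 O) uV sol.
    move=> /(ler_wpM2l kR) /le_trans; apply; rewrite mulr_sumr.
    rewrite /cvrp_cost big_seq [leRHS]big_seq; apply: ler_sum => t tt.
    have -> : tour_len O t = 2 * (tour_len O t / 2) by field.
    apply: radial_tour => //; first by have [] := sol.1 t tt.
      by rewrite divr_ge0// tour_lenE psum_dist_ge0.
    by move=> v /(tour_len_ge O); lra.
  have : 0 <= 3 * pi * D / 2 by rewrite !(divr_ge0, mulr_ge0)// ltW.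
  by lra.
have r0 := Rad0 r erefl.
(* [K] stands for membership in the convex hull of [O :: V]. *)
pose K (x : pt R) :=
  forall p, {in O :: V, forall v, dist v p <= D} -> dist x p <= D.
have KV v : v \in O :: V -> K v by move=> vV p; apply.
have Kseg u v a : 0 <= a <= 1 -> K u -> K v -> K (segpt u v a).
  by move=> a01 Ku Kv p pD; apply: dist_segpt_le => //; [apply: Ku | apply: Kv].
(* The hull has the same diameter bound: [K q] puts all input points in the ball of radius [D]
   around [q], and [K p] then puts [p] there. *)
have KD p q : K p -> K q -> dist p q <= D.
  move=> Kp Kq; apply: Kp => v vV; rewrite dist_sym; apply: Kq => w wV.
  exact: le_diameter.
have [|E [endE farE lenE]] := tours_legs K O r k tours Kseg r0 k0 (KV O OV).
  move=> t tt; have [/allP tV tk] := sol.1 t tt; split=> // y /tV yV.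
  by apply: KV; rewrite inE yV orbT.
have [||W WE lenW] := circle_tour O r D (ends E) D0.
- by move=> p /endE[].
- by move=> p q /endE[_ Kp] /endE[_ Kq]; apply: KD.
have [W' inn lenW'] := connect_legs E W WE.
have : local_cost O V (Some r) <= csum (@dist R) W'.
  apply: tsp_le; first exact: filter_uniq.
  move=> v; rewrite mem_filter => /andP[vfar /sol.2 /hasP[t tt vt]].
  have [e eE ve] := farE t tt v vt vfar.
  exact: inn eE _ ve.
have : rad_cost O V k (Some r)
    <= 2 / k%:R * (\sum_(t <- tours) \sum_(v <- undup t) Num.min (dist O v) r).
  apply: ler_wpM2l => //; apply: (radial_cover _ _ _ _ _ uV sol) => x.
  by rewrite le_min dist_ge0.
by lra.
Qed.
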